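(* Let $A$ be an algebra over a field $F$ with $\operatorname{char}F=p$, $p$ a prime. Then $c_n(A,F)\leqslant c_n(A,p)$ for all $n\in\mathbb N$. Moreover, $c_n(A,\mathbb Z_p)=c_n(A,p)$ for all $n\in\mathbb N$.
   Context: Rings and algebras are associative, not necessarily with unit; $\mathbb N=\{1,2,\dots\}$; $\mathbb Z_p=\mathbb Z/p\mathbb Z$ is the prime field. $\mathbb Z\langle X\rangle$ is the free associative ring without $1$ on $X=\{x_1,x_2,\dots\}$. For a ring $R$, $\operatorname{Id}(R,\mathbb Z)\subseteq\mathbb Z\langle X\rangle$ is the set of $f$ with $f(a_1,\dots,a_n)=0$ for all $a_i\in R$. $P_n(\mathbb Z)$ is the additive subgroup of $\mathbb Z\langle X\rangle$ generated by $x_{\sigma(1)}\cdots x_{\sigma(n)}$, $\sigma\in S_n$. The codimensions $c_n(R,q)$, for $q=0$ or $q$ a prime power, are the multiplicities in $$\frac{P_n(\mathbb Z)}{P_n(\mathbb Z)\cap\operatorname{Id}(R,\mathbb Z)}\cong \mathbb Z^{c_n(R,0)}\oplus\bigoplus_{p\text{ prime}}\bigoplus_{k\in\mathbb N}(\mathbb Z/p^k\mathbb Z)^{c_n(R,p^k)};$$ an algebra is regarded as a ring here. For an algebra $A$ over a field $K$, $\operatorname{Id}(A,K)\subseteq K\langle X\rangle$ is the set of polynomial identities of $A$ with coefficients in $K$, $P_n(K)$ is the $K$-subspace of $K\langle X\rangle$ generated by $x_{\sigma(1)}\cdots x_{\sigma(n)}$, $\sigma\in S_n$, and $c_n(A,K):=\dim_K\frac{P_n(K)}{P_n(K)\cap\operatorname{Id}(A,K)}$.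 An $F$-algebra with $\operatorname{char}F=p$ is regarded as a $\mathbb Z_p$-algebra via $\mathbb Z_p\subseteq F$. *)

(* Defs.v *)
From HB Require Import structures.
From mathcomp Require Import all_boot all_order perm all_algebra all_field.
From mathcomp Require Import finmap.
From mathcomp.multinomials Require Import monalg.
From mathcomp Require Import boolp classical_sets cardinality.

Set Implicit Arguments.
Unset Strict Implicit.
Unset Printing Implicit Defensive.

Import GRing.Theory.
Local Open Scope ring_scope.

(* NU = not necessarily unital. *)

HB.mixin Record Zmodule_isNURing V of GRing.Zmodule V := {
  nmul : V -> V -> V;
  nmulA : associative nmul;
  nmulDl : left_distributive nmul +%R;
  nmulDr : right_distributive nmul +%R
}.

#[short(type="nuRingType")]
HB.structure Definition NURing := {V of GRing.Zmodule V & Zmodule_isNURing V}.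

HB.mixin Record NURing_isNUAlgebra (K : comNzRingType) V
    of NURing V & GRing.Lmodule K V := {
  nscaleAl : forall (a : K) (x y : V), a *: nmul x y = nmul (a *: x) y;
  nscaleAr : forall (a : K) (x y : V), a *: nmul x y = nmul x (a *: y)
}.

#[short(type="nuAlgType")]
HB.structure Definition NUAlgebra (K : comNzRingType) :=
  {V of NURing V & GRing.Lmodule K V & NURing_isNUAlgebra K V}.

(* [zmodule R] (R^z in ssrint) is R with its canonical int-module structure *)
HB.instance Definition _ (R : nuRingType) :=
  Zmodule_isNURing.Build (zmodule R) (@nmulA R) (@nmulDl R) (@nmulDr R).

Section ZAlgebra.
Variable R : nuRingType.
Implicit Types (x y : zmodule R) (a : int).

Lemma zmodule_nscaleAl a x y : a *: nmul x y = nmul (a *: x) y.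
Proof.
pose f z : R := nmul (z : R) y.
have fB : zmod_morphism f.
  have fD u v : f (u + v) = f u + f v by exact: nmulDl.
  have f0 : f 0 = 0 by apply: (@addIr _ (f 0)); rewrite -fD !add0r.
  move=> u v; rewrite fD; congr (_ + _).
  by apply: (@addIr _ (f v)); rewrite -fD !addNr.
pose F := GRing.isZmodMorphism.Build R R f fB.
pose G : {additive R -> R} := HB.pack f F.
by rewrite !scalezrE -[LHS]/(G x *~ a) -raddfMz.
Qed.

Lemma zmodule_nscaleAr a x y : a *: nmul x y = nmul x (a *: y).
Proof.
pose f z : R := nmul (x : R) z.
have fB : zmod_morphism f.
  have fD u v : f (u + v) = f u + f v by exact: nmulDr.
  have f0 : f 0 = 0 by apply: (@addIr _ (f 0)); rewrite -fD !add0r.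
  move=> u v; rewrite fD; congr (_ + _).
  by apply: (@addIr _ (f v)); rewrite -fD !addNr.
pose F := GRing.isZmodMorphism.Build R R f fB.
pose G : {additive R -> R} := HB.pack f F.
by rewrite !scalezrE -[LHS]/(G y *~ a) -raddfMz.
Qed.

HB.instance Definition _ := NURing_isNUAlgebra.Build int (zmodule R)
  zmodule_nscaleAl zmodule_nscaleAr.

End ZAlgebra.


(* A with scalars restricted along 'F_p -> F, a |-> a * 1, where F carries the
   'F_p-algebra structure of [pPrimeCharType charFp]. *)
Section RestrictFp.
Variables (F : fieldType) (p : nat) (charFp : p \in [pchar F]).

Definition Fp_embed (a : 'F_p) : F := in_alg (pPrimeCharType charFp) a.

Definition restrict_Fp (A : nuAlgType F) of p \in [pchar F] : Type := A.

Variable A : nuAlgType F.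
Local Notation B := (restrict_Fp A charFp).

HB.instance Definition _ := NURing.copy B (A : nuRingType).

Definition Fp_scale (a : 'F_p) (x : B) : B := Fp_embed a *: (x : A).

Lemma Fp_scaleA a b x : Fp_scale a (Fp_scale b x) = Fp_scale (a * b) x.
Proof.
rewrite /Fp_scale scalerA; congr (_ *: _).
exact/esym/(rmorphM (in_alg (pPrimeCharType charFp))).
Qed.

Lemma Fp_scale1 : left_id 1 Fp_scale.
Proof.
move=> x; rewrite -[RHS](scale1r (x : A)); congr (_ *: _).
exact: (rmorph1 (in_alg (pPrimeCharType charFp))).
Qed.

Lemma Fp_scaleDr : right_distributive Fp_scale +%R.
Proof. by move=> a x y; exact: (@scalerDr F A). Qed.

Lemma Fp_scaleDl x : {morph Fp_scale^~ x : a b / a + b}.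
Proof.
move=> a b; rewrite -[RHS](@scalerDl F A); congr (_ *: _).
exact: (rmorphD (in_alg (pPrimeCharType charFp))).
Qed.

HB.instance Definition _ := GRing.Zmodule_isLmodule.Build 'F_p B
  Fp_scaleA Fp_scale1 Fp_scaleDr Fp_scaleDl.

Lemma Fp_nscaleAl (a : 'F_p) (x y : B) : a *: nmul x y = nmul (a *: x) y.
Proof. exact: (@nscaleAl F A). Qed.

Lemma Fp_nscaleAr (a : 'F_p) (x y : B) : a *: nmul x y = nmul x (a *: y).
Proof. exact: (@nscaleAr F A). Qed.

HB.instance Definition _ := NURing_isNUAlgebra.Build 'F_p B
  Fp_nscaleAl Fp_nscaleAr.

End RestrictFp.

Section QuotientModule.
Variables (K : nzRingType) (V : lmodType K) (I : {pred V}).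
Hypothesis I_submod : submod_closed I.

Definition lquot_pred : zmodClosed V :=
  HB.pack (I : V -> bool)
    (GRing.isZmodClosed.Build V I (GRing.submod_closedB I_submod)).

Definition lquot : Type := Quotient.quot lquot_pred.

HB.instance Definition _ := GRing.Zmodule.on lquot.

Definition lpi (x : V) : lquot := \pi_(Quotient.quot lquot_pred)%qT x.

Lemma lpiE x y : (lpi x == lpi y) = (x - y \in I).
Proof. exact/esym/(Quotient.idealrBE lquot_pred x y). Qed.

Lemma lpiD x y : lpi (x + y) = lpi x + lpi y.
Proof. exact: (raddfD (\pi_(Quotient.quot lquot_pred)%qT)). Qed.

Lemma lpi_surj (u : lquot) : exists x, u = lpi x.
Proof. by exists (repr (u : Quotient.quot lquot_pred)); rewrite /lpi reprK. Qed.

Definition lquot_scale (a : K) (u : lquot) : lquot :=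
  lpi (a *: repr (u : Quotient.quot lquot_pred)).

Lemma lpiZ a x : lquot_scale a (lpi x) = lpi (a *: x).
Proof.
apply/eqP; rewrite /lquot_scale lpiE -scalerBr ((I_submod : GRing.scaler_closed I)) //.
rewrite -lpiE.
by rewrite /lpi reprK.
Qed.

Lemma lquot_scaleA a b u :
  lquot_scale a (lquot_scale b u) = lquot_scale (a * b) u.
Proof. by have [x ->] := lpi_surj u; rewrite !lpiZ scalerA. Qed.

Lemma lquot_scale1 : left_id 1 lquot_scale.
Proof. by move=> u; have [x ->] := lpi_surj u; rewrite lpiZ scale1r. Qed.

Lemma lquot_scaleDr : right_distributive lquot_scale +%R.
Proof.
move=> a u v; have [[x ->] [y ->]] := (lpi_surj u, lpi_surj v).
by rewrite -lpiD !lpiZ scalerDr lpiD.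
Qed.

Lemma lquot_scaleDl u : {morph lquot_scale^~ u : a b / a + b}.
Proof.
by move=> a b; have [x ->] := lpi_surj u; rewrite !lpiZ scalerDl lpiD.
Qed.

HB.instance Definition _ := GRing.Zmodule_isLmodule.Build K lquot
  lquot_scaleA lquot_scale1 lquot_scaleDr lquot_scaleDl.

End QuotientModule.

(* The value is 0 by convention when V is not finite-dimensional. *)
Definition dimension (K : fieldType) (V : lmodType K) : nat :=
  xget 0%N [set d | exists f : {linear V -> 'rV[K]_d}, bijective f]%classic.

(* The variables are x_0, x_1, ...; K<X>, the free algebra without 1, sits in
   the free algebra with 1 as the polynomials with zero constant term. *)
Definition free_alg (K : comNzRingType) : {pred {malg K[{fmonom nat}]}} :=
  [pred f | f@_(mone) == 0].
Arguments free_alg : clear implicits.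

Section Evaluation.
Variables (K : comNzRingType) (A : nuAlgType K) (a : nat -> A).

(* Only nonempty words are relevant; there is no unit to send [::] to. *)
Definition word_eval (w : seq nat) : A :=
  if w is i :: v then foldl (fun b j => nmul b (a j)) (a i) v else 0.

Definition poly_eval (f : {malg K[{fmonom nat}]}) : A :=
  \sum_(w <- msupp f) f@_w *: word_eval w.

Lemma poly_evalEw f (d : {fset {fmonom nat}}) : (msupp f `<=` d)%fset ->
  poly_eval f = \sum_(w <- d) f@_w *: word_eval w.
Proof.
move=> fd; rewrite /poly_eval; apply: big_fset_incl => // w _ wf.
by rewrite mcoeff_outdom // scale0r.
Qed.

Lemma poly_eval_is_linear : linear poly_eval.
Proof.
move=> c f g; pose d := (msupp (c *: f + g) `|` (msupp f `|` msupp g))%fset.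
have df : (msupp f `<=` d)%fset.
  exact: fsubset_trans (fsubsetUl _ _) (fsubsetUr _ _).
have dg : (msupp g `<=` d)%fset.
  exact: fsubset_trans (fsubsetUr _ _) (fsubsetUr _ _).
rewrite (@poly_evalEw _ d) ?fsubsetUl // (poly_evalEw df) (poly_evalEw dg).
rewrite scaler_sumr -big_split; apply: eq_bigr => w _ /=.
by rewrite mcoeffD mcoeffZ scalerDl scalerA.
Qed.

HB.instance Definition _ :=
  GRing.isLinear.Build K {malg K[{fmonom nat}]} A *:%R poly_eval
    poly_eval_is_linear.

End Evaluation.

Definition Id (K : comNzRingType) (A : nuAlgType K) :
    {pred {malg K[{fmonom nat}]}} :=
  [pred f | (f \in free_alg K) &&
            `[< forall a : nat -> A, poly_eval a f = 0 >]].

(* x_(s 0) x_(s 1) ... x_(s (n - 1)) *)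
Definition mlin_monom (K : comNzRingType) (n : nat) (s : 'S_n) :
    {malg K[{fmonom nat}]} :=
  << FMonom [seq val (s i) | i <- enum 'I_n] >>.
Arguments mlin_monom K {n} s.

Definition mlin (K : comNzRingType) (n : nat) :
    {pred {malg K[{fmonom nat}]}} :=
  [pred f | `[< exists c : 'S_n -> K, f = \sum_s c s *: mlin_monom K s >]].
Arguments mlin : clear implicits.

Lemma Id_submod_closed (K : comNzRingType) (A : nuAlgType K) :
  submod_closed (Id A).
Proof.
split=> [|c f g].
  rewrite inE; apply/andP; split; first by rewrite inE mcoeff0.
  by apply/asboolP => a; rewrite raddf0.
rewrite !inE => /andP[/eqP f1 /asboolP f0] /andP[/eqP g1 /asboolP g0].
apply/andP; split; first by rewrite mcoeffD mcoeffZ f1 g1 mulr0 addr0.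
by apply/asboolP => a; rewrite linearP /= f0 g0 scaler0 addr0.
Qed.

Lemma mlin_submod_closed (K : comNzRingType) (n : nat) :
  submod_closed (mlin K n).
Proof.
split=> [|c f g].
  apply/asboolP; exists (fun=> 0).
  by rewrite big1 // => s _; rewrite scale0r.
move=> /asboolP[u ->] /asboolP[v ->]; apply/asboolP.
exists (fun s => c * u s + v s).
rewrite scaler_sumr -big_split; apply: eq_bigr => s _ /=.
by rewrite scalerDl scalerA.
Qed.

HB.instance Definition _ (K : comNzRingType) (A : nuAlgType K) :=
  GRing.isSubmodClosed.Build K _ (@Id K A) (@Id_submod_closed K A).
HB.instance Definition _ (K : comNzRingType) n :=
  GRing.isSubmodClosed.Build K _ (mlin K n) (@mlin_submod_closed K n).

(* The module P_n(K) *)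
Record mlin_type (K : comNzRingType) (n : nat) := Mlin {
  mlin_val :> {malg K[{fmonom nat}]};
  mlin_valP : mlin_val \in mlin K n
}.

HB.instance Definition _ (K : comNzRingType) n := [isSub for @mlin_val K n].
HB.instance Definition _ (K : comNzRingType) n := [Choice of @mlin_type K n by <:].
HB.instance Definition _ (K : comNzRingType) n :=
  [SubChoice_isSubLmodule of @mlin_type K n by <:].

(* P_n(K) \cap Id(A, K), as a submodule of P_n(K) *)
Definition mlin_Id (K : comNzRingType) (A : nuAlgType K) (n : nat) :
  {pred mlin_type K n} := [pred f | mlin_val f \in Id A].

Lemma mlin_Id_submod_closed (K : comNzRingType) (A : nuAlgType K) n :
  submod_closed (mlin_Id A (n := n)).
Proof.
have [I0 IL] := Id_submod_closed A.
split=> [|c f g fI gI]; first exact: I0.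
have E : mlin_val (c *: f + g) = c *: mlin_val f + mlin_val g.
  exact: (linearP (\val : mlin_type K n -> _)).
rewrite inE E; exact: IL.
Qed.

(* P_n(K) / (P_n(K) \cap Id(A, K)) *)
Definition mlin_quot (K : comNzRingType) (A : nuAlgType K) (n : nat) :
  lmodType K := lquot (mlin_Id_submod_closed A n).

(* c_n(A, K) *)
Definition codim (K : fieldType) (A : nuAlgType K) (n : nat) : nat :=
  dimension (mlin_quot A n).
Arguments codim : clear implicits.

Section DirectSum.
Variables (I : Type) (M : I -> zmodType).

Record dsum := DSum {
  dsum_val :> forall i, M i;
  dsum_finite : finite_set [set i | dsum_val i != 0]%classic
}.

HB.instance Definition _ := gen_eqMixin dsum.
HB.instance Definition _ := gen_choiceMixin dsum.

Lemma dsumP (f g : dsum) : (forall i, f i = g i) -> f = g.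
Proof.
case: f g => [f fF] [g gF] /= fg.
have {}fg : f = g by exact: functional_extensionality_dep.
by case: _ / fg in gF *; congr DSum; exact: Prop_irrelevance.
Qed.

Lemma dsum_zero_finite : finite_set [set i | (0 : M i) != 0]%classic.
Proof. by apply: sub_finite_set (finite_set0 I) => i /=; rewrite eqxx. Qed.
Definition dsum_zero := DSum dsum_zero_finite.

Lemma dsum_opp_finite (f : dsum) : finite_set [set i | - f i != 0]%classic.
Proof. by apply: sub_finite_set (dsum_finite f) => i /=; rewrite oppr_eq0. Qed.
Definition dsum_opp f := DSum (dsum_opp_finite f).

Lemma dsum_add_finite (f g : dsum) :
  finite_set [set i | f i + g i != 0]%classic.
Proof.
apply: (@sub_finite_set _ _ ([set i | f i != 0] `|` [set i | g i != 0])%classic).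
  move=> i /=; have [->|fi] := eqVneq (f i) 0; last by left.
  by rewrite add0r; right.
by rewrite finite_setU; split; exact: dsum_finite.
Qed.
Definition dsum_add f g := DSum (dsum_add_finite f g).

Lemma dsum_addA : associative dsum_add.
Proof. by move=> f g h; apply: dsumP => i; exact: addrA. Qed.
Lemma dsum_addC : commutative dsum_add.
Proof. by move=> f g; apply: dsumP => i; exact: addrC. Qed.
Lemma dsum_add0 : left_id dsum_zero dsum_add.
Proof. by move=> f; apply: dsumP => i; exact: add0r. Qed.
Lemma dsum_addN : left_inverse dsum_zero dsum_opp dsum_add.
Proof. by move=> f; apply: dsumP => i; exact: addNr. Qed.

HB.instance Definition _ :=
  GRing.isZmodule.Build dsum dsum_addA dsum_addC dsum_add0 dsum_addN.

End DirectSum.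

Definition prime_power := {pk : nat * nat | prime pk.1 && (0 < pk.2)%N}.

(* Z^(m 0) (+) \bigoplus_(p prime) \bigoplus_(k >= 1) (Z/p^k)^(m (p^k)); here
   'Z_(p ^ k) is the true Z/p^k because p ^ k > 1. *)
Definition primary_sum (m : nat -> nat) : zmodType :=
  ('rV[int]_(m 0%N) *
   dsum (fun q : prime_power =>
     'rV['Z_((val q).1 ^ (val q).2)]_(m ((val q).1 ^ (val q).2)%N)))%type.

(* The multiplicity of Z (q = 0) or of Z/q (q a prime power) in a
   decomposition of G as a direct sum of primary cyclic groups.  It is
   determined by G when G is finitely generated; it has no meaning at the
   other q. *)
Definition multiplicity (G : zmodType) : nat -> nat :=
  xget (fun=> 0%N)
    [set m | exists f : {additive G -> primary_sum m}, bijective f]%classic.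

(* c_n(R, q) for q = 0 or a prime power *)
Definition rcodim (R : nuRingType) (n q : nat) : nat :=
  multiplicity (mlin_quot (zmodule R) n) q.

(* Main.v *)
Require Import Defs.
From mathcomp Require Import all_boot all_order perm all_algebra all_field.
From HB Require Import structures.
From mathcomp Require Import finmap.
From mathcomp.multinomials Require Import monalg.
From mathcomp Require Import boolp classical_sets cardinality.

(** Everything is read off from coefficient vectors.  A multilinear polynomial
    of degree n over K is a row vector u indexed by the permutations of n
    letters, and, for n > 0, it is an identity of A exactly when
    [mlin_identity A u] holds.  The quotient of P_n(K) by its identities is the
    image of the map [mlin_pres], defined on K^(n!), whose kernel consists of
    the identities ([mlin_pres_ker]).

    Over a field the identities form the row space of a matrix M
    ([mlin_identity_mx]), so c_n(A, K) = n! - rank M ([codimE]).  A vector over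
    F_p is an identity of the restricted algebra iff its image over F is an
    identity of A ([mlin_identity_restrict]).  So the matrix for F_p, mapped to
    F, lies in the row space of the matrix for F.  Extension of scalars
    preserves the rank, whence c_n(A, F) <= c_n(A, F_p).

    An integer vector is an identity of the ring A iff its reduction modulo p is
    an identity over F_p, because pA = 0 ([mlin_identity_zmodule]).  As reduction
    is surjective, the quotients over Z and over F_p are isomorphic groups, so
    the former is (Z/p)^d with d = c_n(A, F_p) ([mlin_quot_zmodule]).  It remains
    to see that the multiplicity of Z/p in this group is d in whichever
    decomposition is chosen ([multiplicity_elementary]): since p kills the group,
    every other primary summand vanishes, and then one counts elements. *)

Set Implicit Arguments.
Unset Strict Implicit.
Unset Printing Implicit Defensive.

Import GRing.Theory.
Local Open Scope ring_scope.

(** * Linear algebra *)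

Lemma inj_surj_bij (T U : Type) (f : T -> U) :
  injective f -> (forall y, exists x, f x = y) -> bijective f.
Proof.
move=> f_inj f_surj; have [g gK] := choice f_surj.
by exists g => // x; apply: f_inj; rewrite gK.
Qed.

(** The ranks of matrices whose row space lies in P are bounded.  One of maximal
    rank cannot be enlarged by a vector of P, so its row space is all of P. *)
Lemma row_subspace_mx (K : fieldType) (N : nat) (P : 'rV[K]_N -> Prop) :
    P 0 -> (forall c u v, P u -> P v -> P (c *: u + v)) ->
  exists M : 'M[K]_N, forall u, P u <-> (u <= M)%MS.
Proof.
move=> P0 PL.
pose Q r := `[< exists M : 'M[K]_N,
                  (forall u, (u <= M)%MS -> P u) /\ \rank M = r >].
have Q0 : exists r, Q r.
  exists 0%N; apply/asboolP; exists 0; split; last exact: mxrank0.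
  by move=> u; rewrite submx0 => /eqP->.
have QN r : Q r -> (r <= N)%N by move=> /asboolP[M [_ <-]]; exact: rank_leq_row.
case: (ex_maxnP Q0 QN) => r /asboolP[M [MP rM]] rmax.
exists M => u; split=> [Pu|/MP//].
have : Q (\rank (M + u)%MS).
  apply/asboolP; exists (M + u)%MS; split=> // v /sub_addsmxP[[v1 v2] /= ->].
  rewrite addrC; have /sub_rVP[c ->] := submxMl v2 u.
  by apply: PL => //; apply: MP; exact: submxMl.
move=> /rmax; rewrite -rM => rk; apply: submx_trans (addsmxSr M u) _.
by rewrite (geq_leqif (mxrank_leqif_sup (addsmxSl M u))) in rk.
Qed.

Lemma leq_rV_inj (K : fieldType) (d e : nat)
    (f : {linear 'rV[K]_d -> 'rV[K]_e}) : injective f -> (d <= e)%N.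
Proof.
move=> f_inj; have : row_free (lin1_mx f).
  apply/inj_row_free => v; rewrite mul_rV_lin1 => fv0.
  by apply: f_inj; rewrite fv0 raddf0.
by move=> /eqP <-; exact: rank_leq_col.
Qed.

(** The function [dimension] returns some d with V isomorphic to K^d; invariance
    of dimension shows that it is the given one. *)
Lemma dimension_eq (K : fieldType) (V : lmodType K) (d : nat)
    (g : {linear 'rV[K]_d -> V}) : bijective g -> dimension V = d.
Proof.
move=> [f gK fK].
pose F : {linear V -> 'rV_d} :=
  HB.pack f (GRing.isLinear.Build K V _ _ f (can2_linear gK fK)).
have : exists d', exists f : {linear V -> 'rV[K]_d'}, bijective f.
  by exists d, F; exists g.
move=> /(xgetPex 0%N) /=; rewrite -/(dimension V) => -[h [k hK kK]].
pose k' : {linear 'rV_(dimension V) -> V} :=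
  HB.pack k (GRing.isLinear.Build K _ V _ k (can2_linear hK kK)).
apply/eqP; rewrite eqn_leq; apply/andP; split.
  apply: (@leq_rV_inj K _ _ (F \o k')) => x y /= /(can_inj fK).
  exact: (can_inj kK).
apply: (@leq_rV_inj K _ _ (h \o g)) => x y /= /(can_inj hK).
exact: (can_inj gK).
Qed.

(** The restriction of phi to a complement of its kernel is an isomorphism. *)
Lemma coimage_basis (K : fieldType) (N : nat) (V : lmodType K)
    (phi : {linear 'rV[K]_N -> V}) (M : 'M[K]_N) :
    (forall v, exists u, phi u = v) -> (forall u, phi u = 0 <-> (u <= M)%MS) ->
  exists g : {linear 'rV[K]_(N - \rank M) -> V}, bijective g.
Proof.
move=> phi_surj phi_ker; rewrite -mxrank_compl.
pose C := row_base (M^C)%MS; exists (phi \o mulmxr C); apply: inj_surj_bij.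
  move=> x y /eqP; rewrite -subr_eq0 -raddfB /= => /eqP/phi_ker xyM.
  apply/eqP; rewrite -subr_eq0 -(mulmx_free_eq0 _ (row_base_free _)) -/C.
  have : ((x - y) *m C <= M :&: M^C)%MS.
    by rewrite sub_capmx xyM (submx_trans (submxMl _ _)) ?eq_row_base.
  by rewrite capmx_compl submx0.
move=> v; have [u <-] := phi_surj v.
have : (u <= M + M^C)%MS by rewrite submx_full // addsmx_compl_full.
move=> /sub_addsmxP[[a b] /= ->].
have : (b *m M^C <= C)%MS by rewrite eq_row_base submxMl.
move=> /submxP[w wE]; exists w; rewrite /= -wE raddfD /=.
by rewrite (iffRL (phi_ker (a *m M))) ?add0r ?submxMl.
Qed.

(** Both groups are X modulo the common kernel. *)
Lemma iso_of_same_kernel (X G V : zmodType)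
    (phi : {additive X -> G}) (psi : {additive X -> V}) :
    (forall g, exists x, phi x = g) -> (forall v, exists x, psi x = v) ->
    (forall x, phi x = 0 <-> psi x = 0) ->
  exists f : {additive G -> V}, bijective f.
Proof.
move=> phi_surj psi_surj ker; have [s sK] := choice phi_surj.
(* The section s need not be additive, but psi \o s is. *)
have fB : zmod_morphism (psi \o s).
  move=> g h; apply/eqP; rewrite /= -raddfB -subr_eq0 -raddfB; apply/eqP/ker.
  by rewrite !(raddfB phi) !sK subrr.
pose f : {additive G -> V} :=
  HB.pack (psi \o s) (GRing.isZmodMorphism.Build G V _ fB).
exists f; apply: inj_surj_bij => [g h /= /eqP|v].
  rewrite -subr_eq0 -raddfB => /eqP/ker/eqP.
  by rewrite raddfB !sK subr_eq0 => /eqP.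
have [x <-] := psi_surj v; exists (phi x) => /=.
by apply/eqP; rewrite -subr_eq0 -raddfB; apply/eqP/ker; rewrite raddfB sK subrr.
Qed.

(** * Multilinear polynomials as coefficient vectors *)

Section Presentation.
Variables (K : comNzRingType) (A : nuAlgType K) (n : nat).
Local Notation N := #|{: 'S_n}|.

Definition perm_word (s : 'S_n) : seq nat := [seq val (s i) | i <- enum 'I_n].

Definition mlin_identity (u : 'rV[K]_N) : Prop :=
  forall a : nat -> A,
    \sum_s u 0 (enum_rank s) *: word_eval a (perm_word s) = 0.

Definition mlin_poly (u : 'rV[K]_N) : {malg K[{fmonom nat}]} :=
  \sum_s u 0 (enum_rank s) *: mlin_monom K s.

Lemma mlin_poly_mlin u : mlin_poly u \in mlin K n.
Proof. by apply/asboolP; exists (fun s => u 0 (enum_rank s)). Qed.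

Definition mlin_pres (u : 'rV[K]_N) : mlin_quot A n :=
  lpi (mlin_Id_submod_closed A n) (Mlin (mlin_poly_mlin u)).

Lemma mlin_pres_linear : linear mlin_pres.
Proof.
move=> c u v; rewrite /mlin_pres -[RHS]/(lquot_scale _ _ + _) lpiZ -lpiD.
congr lpi; apply: val_inj => /=.
rewrite /mlin_poly scaler_sumr -big_split.
by apply: eq_bigr => s _; rewrite !mxE scalerDl scalerA.
Qed.

HB.instance Definition _ := GRing.isLinear.Build K _ _ _ mlin_pres
  mlin_pres_linear.

Lemma mlin_pres_surj x : exists u, mlin_pres u = x.
Proof.
have [[f fP] ->] := lpi_surj x; have /asboolP[c fE] := fP.
exists (\row_i c (enum_val i)); congr lpi; apply: val_inj => /=.
by rewrite fE; apply: eq_bigr => s _; rewrite mxE enum_rankK.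
Qed.

Lemma poly_eval_monom (a : nat -> A) (s : 'S_n) :
  poly_eval a (mlin_monom K s) = word_eval a (perm_word s).
Proof.
rewrite (@poly_evalEw _ _ _ _ [fset FMonom (perm_word s)]%fset).
  by rewrite big_seq_fset1 mcoeffU eqxx scale1r.
by rewrite /mlin_monom msuppU oner_eq0.
Qed.

Lemma poly_eval_mlin (a : nat -> A) (u : 'rV[K]_N) :
  poly_eval a (mlin_poly u) =
  \sum_s u 0 (enum_rank s) *: word_eval a (perm_word s).
Proof.
rewrite raddf_sum /=; apply: eq_bigr => s _.
by rewrite linearZ /= poly_eval_monom.
Qed.

(** For n = 0 the only monomial is the empty word, a nonzero constant term. *)
Lemma mlin_poly_free_alg u : (0 < n)%N -> mlin_poly u \in free_alg K.
Proof.
move=> n_gt0; rewrite inE raddf_sum big1 //= => s _.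
rewrite mcoeffZ mcoeffU; case: eqP => [|_]; last by rewrite mulr0.
move=> /(congr1 (fun w : {fmonom nat} => size w)) /esym/eqP.
rewrite fm1 size_map size_enum_ord /= => n_eq0.
by move: n_gt0; rewrite lt0n eq_sym n_eq0.
Qed.

Lemma mlin_pres_ker u : (0 < n)%N -> mlin_pres u = 0 <-> mlin_identity u.
Proof.
move=> n_gt0; have uE : (mlin_pres u == 0) = (mlin_poly u \in Id A).
  rewrite -(raddf0 mlin_pres) lpiE inE /=.
  rewrite [X in _ - X]big1 ?subr0 // => s _.
  by rewrite mxE scale0r.
split=> [/eqP|u_id].
  by rewrite uE inE => /andP[_ /asboolP u0] a; rewrite -poly_eval_mlin.
apply/eqP; rewrite uE inE mlin_poly_free_alg //=.
by apply/asboolP => a; rewrite poly_eval_mlin.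
Qed.

End Presentation.

(** * Codimensions over a field as ranks *)

Lemma mlin_identity_mx (K : fieldType) (A : nuAlgType K) (n : nat) :
  exists M : 'M[K]_#|{: 'S_n}|, forall u, mlin_identity A u <-> (u <= M)%MS.
Proof.
apply: row_subspace_mx => [a|c u v uI vI a].
  by rewrite big1 // => s _; rewrite mxE scale0r.
transitivity (c *: (0 : A) + 0); last by rewrite scaler0 addr0.
rewrite -[X in _ = _ *: X + _](uI a) -[X in _ = _ + X](vI a).
rewrite scaler_sumr -big_split; apply: eq_bigr => s _ /=.
by rewrite !mxE scalerDl scalerA.
Qed.

Section Rank.
Variables (K : fieldType) (A : nuAlgType K) (n : nat).
Variable M : 'M[K]_#|{: 'S_n}|.
Hypothesis (n_gt0 : (0 < n)%N).
Hypothesis (M_id : forall u, mlin_identity A u <-> (u <= M)%MS).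

Lemma mlin_quot_basis :
  exists g : {linear 'rV[K]_(#|{: 'S_n}| - \rank M) -> mlin_quot A n},
    bijective g.
Proof.
apply: (coimage_basis (phi := mlin_pres A (n := n))).
  exact: mlin_pres_surj.
by move=> u; apply: iff_trans (M_id u); exact: mlin_pres_ker.
Qed.

Lemma codimE : codim K A n = (#|{: 'S_n}| - \rank M)%N.
Proof. by have [g /dimension_eq] := mlin_quot_basis. Qed.

End Rank.

Lemma codim_iso (K : fieldType) (A : nuAlgType K) (n : nat) : (0 < n)%N ->
  exists f : {linear mlin_quot A n -> 'rV[K]_(codim K A n)}, bijective f.
Proof.
move=> n_gt0; have [M MP] := mlin_identity_mx A n; rewrite (codimE n_gt0 MP).
have [g [f gK fK]] := mlin_quot_basis n_gt0 MP.
pose f' : {linear mlin_quot A n -> 'rV_(#|{: 'S_n}| - \rank M)} :=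
  HB.pack f (GRing.isLinear.Build K _ _ _ f (can2_linear gK fK)).
by exists f'; exists g.
Qed.

(** * Change of scalars *)

Section Restriction.
Variables (F : fieldType) (p : nat) (charFp : p \in [pchar F]).
Variables (A : nuAlgType F) (n : nat).
Local Notation B := (restrict_Fp A charFp).
Local Notation N := #|{: 'S_n}|.

HB.instance Definition _ := GRing.RMorphism.copy (Fp_embed charFp : 'F_p -> F)
  (in_alg (pPrimeCharType charFp)).

Lemma mlin_identity_restrict (u : 'rV['F_p]_N) :
  mlin_identity B u <-> mlin_identity A (map_mx (Fp_embed charFp) u).
Proof.
by split=> uI a; rewrite -[RHS](uI a); apply: eq_bigr => s _; rewrite mxE.
Qed.

(** Integers act on A through F_p. *)
Lemma mlin_identity_zmodule (u : 'rV[int]_N) :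
  mlin_identity (zmodule A) u <-> mlin_identity B (map_mx intr u).
Proof.
have E a : \sum_s u 0 (enum_rank s)
               *: word_eval (A := zmodule A) a (perm_word s)
         = \sum_s (map_mx intr u : 'rV['F_p]_N) 0 (enum_rank s)
               *: word_eval (A := B) a (perm_word s).
  by apply: eq_bigr => s _; rewrite mxE scaler_int.
by split=> uI a; rewrite -[RHS](uI a); [exact/esym/E|exact: E].
Qed.

Lemma codim_restrict : (0 < n)%N -> (codim F A n <= codim 'F_p B n)%N.
Proof.
move=> n_gt0; have [M MP] := mlin_identity_mx A n.
have [L LP] := mlin_identity_mx B n.
rewrite (codimE n_gt0 MP) (codimE n_gt0 LP) leq_sub2l //.
rewrite -(mxrank_map (Fp_embed charFp)); apply: mxrankS.
apply/row_subP => i; rewrite -map_row; apply/MP/mlin_identity_restrict/LP.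
exact: row_sub.
Qed.

(** The surjections from Z^(n!) onto the quotient over Z, and through F_p^(n!)
    onto the quotient over F_p, have the same kernel. *)
Lemma mlin_quot_zmodule : (0 < n)%N ->
  exists f : {additive mlin_quot (zmodule A) n -> 'rV['Z_p]_(codim 'F_p B n)},
    bijective f.
Proof.
move=> n_gt0; have [g [h gK hK]] := codim_iso B n_gt0.
have p_pr := pcharf_prime charFp.
have : exists f : {additive mlin_quot (zmodule A) n ->
                     'rV['F_p]_(codim 'F_p B n)}, bijective f.
  apply: (iso_of_same_kernel (phi := mlin_pres (zmodule A) (n := n))
           (psi := g \o mlin_pres B (n := n) \o map_mx intr)).
  - exact: mlin_pres_surj.
  - move=> v; have [u uE] := mlin_pres_surj (h v).
    exists (map_mx (fun x : 'F_p => (x : nat)%:Z) u) => /=.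
    rewrite -[RHS]hK -uE; congr (g (mlin_pres B _)).
    by apply/rowP => i; rewrite !mxE; exact: natr_Zp.
  - move=> u; apply: iff_trans (mlin_pres_ker _ u n_gt0) _.
    apply: iff_trans (mlin_identity_zmodule u) _.
    apply: iff_trans (iff_sym (mlin_pres_ker _ _ n_gt0)) _ => /=.
    split=> [->|]; first exact: raddf0.
    by rewrite -[in X in X -> _](raddf0 g) => /(can_inj gK).
(* By definition 'F_p is 'Z_(pdiv p). *)
by move: (codim _ _ _) => d; rewrite (pdiv_id p_pr).
Qed.

End Restriction.

(** * The multiplicity of Z/p in an elementary abelian group *)

Lemma rV0_eq (R : Type) (d : nat) (u v : 'rV[R]_d) : d = 0%N -> u = v.
Proof.
move=> d0; apply/rowP => j.
by have := ltn_ord j; rewrite [X in (_ < X)%N]d0.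
Qed.

Lemma dvdn_pfactor_prime (l k p : nat) : prime l -> prime p -> (0 < k)%N ->
  (l ^ k %| p)%N -> (l, k) = (p, 1%N).
Proof.
move=> l_pr p_pr k_gt0 lkp.
have /eqP lp : l == p by rewrite -dvdn_prime2 // (dvdn_trans (dvdn_exp _ _) lkp).
move: lkp; rewrite {}lp => /(dvdn_leq (prime_gt0 p_pr)).
rewrite -{2}[p]expn1 leq_exp2l ?prime_gt1 // => k_le1.
by congr pair; apply/eqP; rewrite eqn_leq k_le1.
Qed.

Section Single.
Variables (I : eqType) (M : I -> zmodType) (i : I) (x : M i).

Lemma dsum_single_finite :
  finite_set [set j | dfwith (fun j => 0 : M j) x j != 0]%classic.
Proof.
apply: sub_finite_set (finite_set1 i) => j /=.
by case: dfwithP => // k _; rewrite eqxx.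
Qed.

Definition dsum_single : dsum M := DSum dsum_single_finite.

End Single.

Lemma dsum_valMn (I : Type) (M : I -> zmodType) (x : dsum M) k i :
  (x *+ k) i = x i *+ k.
Proof. by elim: k => // k IHk; rewrite !mulrS -IHk. Qed.

Section PrimarySum.
Variables (m : nat -> nat) (p : nat).
Hypothesis p_pr : prime p.

(** The family summed in [primary_sum], named so that [dsum_single] can be
    applied to it. *)
Definition primary_part (q : prime_power) : zmodType :=
  'rV['Z_((val q).1 ^ (val q).2)]_(m ((val q).1 ^ (val q).2)%N).

Definition prime_power1 : prime_power :=
  exist (fun pk : nat * nat => prime pk.1 && (0 < pk.2)%N) (p, 1%N)
    (introT andP (conj p_pr isT)).

(* The type relies on p ^ 1 being convertible to p. *)
Definition proj_p (x : primary_sum m) : 'rV['Z_p]_(m p) := x.2 prime_power1.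

Lemma proj_p_additive : zmod_morphism proj_p.
Proof. by []. Qed.

HB.instance Definition _ :=
  GRing.isZmodMorphism.Build _ _ proj_p proj_p_additive.

(** Only the values of m that matter are constrained: [primary_sum] never looks
    at m q when q is neither 0 nor a prime power. *)
Definition concentrated : Prop :=
  m 0%N = 0%N /\
  forall q : prime_power, q != prime_power1 ->
    m ((val q).1 ^ (val q).2)%N = 0%N.

Lemma proj_p_bij : concentrated -> bijective proj_p.
Proof.
move=> [m0 mq]; apply: inj_surj_bij => [[a x] [b y] xy|v].
  congr pair; first exact: rV0_eq.
  apply: dsumP => q; have [->//|/mq mq0] := eqVneq q prime_power1.
  exact: rV0_eq.
exists (0, dsum_single (M := primary_part) (i := prime_power1) v).
by rewrite /proj_p /= dfwith_in.
Qed.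

(** A nonzero summand Z or Z/(l^k) killed by p must be Z/p: look at its
    element 1. *)
Lemma torsion_concentrated :
  (forall x : primary_sum m, x *+ p = 0) -> concentrated.
Proof.
move=> tor; split.
  apply/eqP; rewrite -leqn0 leqNgt; apply/negP => m_gt0.
  have /(congr1 (fun x : primary_sum m => x.1 0 (Ordinal m_gt0))) :=
    tor (const_mx 1, 0).
  rewrite (raddfMn fst) /= mulmxnE !mxE => /eqP.
  by rewrite Num.Theory.pnatr_eq0 => /eqP p0; move: p_pr; rewrite p0.
move=> q q1; apply/eqP; rewrite -leqn0 leqNgt; apply/negP => m_gt0.
pose x := dsum_single (M := primary_part) (i := q) (const_mx 1).
have /(congr1 (fun x : primary_sum m => x.2 q 0 (Ordinal m_gt0))) := tor (0, x).
rewrite (raddfMn snd) /= dsum_valMn /= dfwith_in mulmxnE !mxE.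
case: q {x m_gt0} q1 => -[l k] /= lk q1.
have /andP[/= l_pr k_gt0] := lk.
have lk_gt1 : (1 < l ^ k)%N by rewrite -(exp1n k) ltn_exp2r ?prime_gt1.
move=> /(congr1 (@nat_of_ord _)); rewrite val_Zp_nat //= => /eqP lkp.
by case/eqP: q1; apply: val_inj; exact: dvdn_pfactor_prime lkp.
Qed.

End PrimarySum.

(** A decomposition exists, the one with m p = d and m q = 0 for q <> p.  For any
    other m the summands away from p vanish, so p^d = #|G| = p^(m p). *)
Lemma multiplicity_elementary (G : zmodType) (p d : nat) : prime p ->
    (exists f : {additive G -> 'rV['Z_p]_d}, bijective f) ->
  multiplicity G p = d.
Proof.
move=> p_pr [f [fi fK fiK]].
have torG (x : G) : x *+ p = 0.
  apply: (can_inj fK); rewrite raddfMn raddf0; apply/rowP => i.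
  by rewrite mulmxnE mxE -mulr_natr pchar_Zp ?mulr0 ?prime_gt1.
have : exists m, exists h : {additive G -> primary_sum m}, bijective h.
  pose m q := if q == p then d else 0%N; exists m.
  have m_p : concentrated m p_pr.
    split; first by rewrite /m; case: eqP p_pr => // <-.
    move=> [[l k] /= lk] q1; rewrite /m; case: eqP => //= lkE; case/eqP: q1.
    have /andP[l_pr k_gt0] := lk.
    by apply: val_inj; apply: dvdn_pfactor_prime => //; rewrite lkE.
  have [g gK hK] := proj_p_bij m_p.
  pose g' : {additive 'rV['Z_p]_(m p) -> primary_sum m} :=
    HB.pack g (GRing.isZmodMorphism.Build _ _ g (can2_zmod_morphism gK hK)).
  have mp : m p = d by rewrite /m eqxx.
  rewrite -{}mp in f fi fK fiK.
  by exists (g' \o f); apply: bij_comp; [exists (proj_p p_pr)|exists fi].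
move=> /(xgetPex (fun=> 0%N)) /=; rewrite -/(multiplicity G).
move: (multiplicity G) => m -[h [hi hK hiK]].
have tor (x : primary_sum m) : x *+ p = 0.
  by rewrite -[x]hiK -raddfMn torG raddf0.
have /proj_p_bij pr_bij := torsion_concentrated p_pr tor.
have /bij_eq_card : bijective (proj_p p_pr \o (h \o fi)).
  by apply: bij_comp => //; apply: bij_comp; [exists hi|exists f].
rewrite !card_mx !mul1n card_ord Zp_cast ?prime_gt1 //.
by move/eqP; rewrite eqn_exp2l ?prime_gt1 // => /eqP.
Qed.

Theorem proposition3 (F : fieldType) (p : nat) (charFp : p \in [pchar F]%R)
    (A : nuAlgType F) :
  (forall n : nat, 0 < n -> codim F A n <= rcodim A n p)%N /\
  (forall n : nat, 0 < n ->
     codim 'F_p (restrict_Fp A charFp) n = rcodim A n p)%N.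
Proof.
have codim_p n : (0 < n)%N -> codim 'F_p (restrict_Fp A charFp) n = rcodim A n p.
  move=> n_gt0; apply/esym/multiplicity_elementary.
    exact: pcharf_prime charFp.
  exact: mlin_quot_zmodule.
split=> n n_gt0; last exact: codim_p.
by rewrite -codim_p //; exact: codim_restrict.
Qed.
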